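(* Let $C_n$ be a cycle with standard orientation and all edge labels the same. Let $\mathfrak{a}$ denote the abelian factor of the associated Lie algebra $\mathfrak{n}_{C_n}$. (1) If $n$ is even, $n=2k$, then the dimension of $\mathfrak{a}$ is $2$, with basis $\left\{\sum_{i=1}^{k}v_{2i-1},\ \sum_{i=1}^{k}v_{2i}\right\}$. (2) If $n$ is odd, then the dimension of $\mathfrak{a}$ is $1$, with basis $\left\{\sum_{i=1}^{n}v_i\right\}$.
   Context: A directed edge-labeled graph $G=(V,E,C)$ is a finite connected directed graph with vertex set $V=\{v_1,\dots,v_n\}$ and edge set $E$, together with a surjective labeling $c:E\to C=\{Z_1,\dots,Z_p\}$ (labels may be repeated on different edges). An edge directed from $v$ to $w$ is written $(v,w)$. The Lie algebra $\mathfrak{n}_G$: as a real vector space $\mathfrak{n}_G=\mathfrak{v}\oplus\mathfrak{w}$, where $\mathfrak{v}$ has basis $V$ and $\mathfrak{w}$ has basis $C$. The bracket is bilinear and skew-symmetric with $[v_i,v_j]=\sum_{\ell}(\epsilon_\ell-\epsilon'_\ell)Z_\ell$, where $\epsilon_\ell=1$ if $c(v_i,v_j)=Z_\ell$ and $0$ otherwise, and $\epsilon'_\ell=1$ if $c(v_j,v_i)=Z_\ell$ and $0$ otherwise; all other brackets of basis elements are zero. For a simple graph the derived algebra is $[\mathfrak{n}_G,\mathfrak{n}_G]=\mathfrak{w}$. The abelian factor of $\mathfrak{n}_G$ is the unique subspace $\mathfrak{a}\subseteq\mathfrak{v}$ such that the center satisfies $\mathcal{Z}(\mathfrak{n}_G)=[\mathfrak{n}_G,\mathfrak{n}_G]\oplus\mathfrak{a}$.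 $C_n$ ($n\ge 3$) is the cycle with vertices $v_1,\dots,v_n$ and $n$ edges, $v_i$ adjacent to $v_{i+1}$ for $1\le i\le n-1$ and $v_n$ adjacent to $v_1$. It has standard orientation if its edges are directed as $(v_i,v_{i+1})$ for $1\le i\le n-1$ and $(v_n,v_1)$. *)

(* Defs.v *)
From HB Require Import structures.
From mathcomp Require Import all_boot all_order all_algebra.
From mathcomp Require Import reals.

Set Implicit Arguments.
Unset Strict Implicit.
Unset Printing Implicit Defensive.

Import Order.TTheory GRing.Theory Num.Theory.
Local Open Scope ring_scope.

HB.mixin Record isLieAlgebra (K : fieldType) L of Vector K L := {
  lie : L -> L -> L;
  lieDl : forall x y z : L, lie (x + y) z = lie x z + lie y z;
  lieZl : forall (a : K) (x y : L), lie (a *: x) y = a *: lie x y;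
  lieDr : forall x y z : L, lie x (y + z) = lie x y + lie x z;
  lieZr : forall (a : K) (x y : L), lie x (a *: y) = a *: lie x y;
  liexx : forall x : L, lie x x = 0;
  lie_jacobi : forall x y z : L,
    lie x (lie y z) + lie y (lie z x) + lie z (lie x y) = 0
}.

#[short(type="lieAlgType")]
HB.structure Definition LieAlgebra (K : fieldType) :=
  {L of Vector K L & isLieAlgebra K L}.

Section LieTheory.
Variables (K : fieldType) (L : lieAlgType K).
Implicit Types x y z : L.

Fact lie_linear x : linear (lie x).
Proof. by move=> a y z; rewrite lieDr lieZr. Qed.
HB.instance Definition _ x := GRing.isLinear.Build K L L *:%R (lie x)
  (lie_linear x).

Definition ad x : 'End(L) := linfun (lie x).

Lemma adE x y : ad x y = lie x y.
Proof. exact: lfunE. Qed.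

Fact ad_linear : linear ad.
Proof.
move=> a x y; apply/lfunP => z.
by rewrite add_lfunE scale_lfunE !adE lieDl lieZl.
Qed.
HB.instance Definition _ := GRing.isLinear.Build K L 'End(L) *:%R ad ad_linear.

(* The center is the kernel of the adjoint representation. *)
Definition center : {vspace L} := lker (linfun ad).

Lemma centerP z : reflect (forall x, lie z x = 0) (z \in center).
Proof.
rewrite memv_ker lfunE /=; apply: (iffP eqP) => [z0 x|z0].
  by rewrite -adE z0 lfunE.
by apply/lfunP => x; rewrite adE z0 lfunE.
Qed.

(* By bilinearity this is the span of all brackets: see [mem_derived] and
   [derived_min]. *)
Definition derived : {vspace L} :=
  (\sum_(i < \dim {:L}) limg (ad (vbasis {:L})`_i))%VS.

Lemma mem_derived x y : lie x y \in derived.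
Proof.
rewrite -adE (coord_vbasis (memvf x)) linear_sum sum_lfunE.
apply: rpred_sum => i _; rewrite linearZ scale_lfunE rpredZ //.
by apply: subv_trans (memv_img _ (memvf y)) (sumv_sup i _ _).
Qed.

Lemma derived_min (U : {vspace L}) :
  (forall x y, lie x y \in U) -> (derived <= U)%VS.
Proof.
move=> hU; apply/subv_sumP => i _; apply/subvP => _ /memv_imgP[y _ ->].
by rewrite adE.
Qed.

End LieTheory.

Record lgraph (V C : finType) := LGraph {
  edges : {set V * V};
  label : {e : V * V | e \in edges} -> C;
  label_surj : forall Z : C, exists e, label e = Z;
  edges_connected : forall x y : V,
    connect (fun u v => ((u, v) \in edges) || ((v, u) \in edges)) x y
}.

Arguments label {V C} G e : rename.

Definition labeled (V C : finType) (G : lgraph V C) (u v : V) (Z : C) : bool :=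
  [exists e : {e : V * V | e \in edges G}, (val e == (u, v)) && (label G e == Z)].

(* Taking [u = v] excludes loops; parallel edges in the same direction are
   excluded by [edges] being a set. *)
Definition simple_graph (V C : finType) (G : lgraph V C) : Prop :=
  forall u v : V, (u, v) \in edges G -> (v, u) \notin edges G.

Definition nLie (R : realType) (V C : finType) (G : lgraph V C) : Type :=
  ({ffun V -> R^o} * {ffun C -> R^o})%type.

HB.instance Definition _ (R : realType) (V C : finType) (G : lgraph V C) :=
  Vector.on (nLie R G).

Section NLie.
Variables (R : realType) (V C : finType) (G : lgraph V C).
Local Notation nG := (nLie R G).
Implicit Types (x y z : nG) (u v : V) (Z : C).

Definition vvec v : nG := ([ffun u => (u == v)%:R], 0).
Definition zvec Z : nG := (0, [ffun Y => (Y == Z)%:R]).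

Definition vpart : {vspace nG} := <<[seq vvec v | v : V]>>%VS.
Definition zpart : {vspace nG} := <<[seq zvec Z | Z : C]>>%VS.

(* [labeled G u v Z] is 1 exactly when $(u,v)$ is an edge with label $Z$. *)
Definition structc u v Z : R := (labeled G u v Z)%:R - (labeled G v u Z)%:R.

(* The bilinear extension of the bracket on vertices: see [lie_vvec]. *)
Definition nbr x y : nG :=
  (0, [ffun Z => \sum_u \sum_v x.1 u * y.1 v * structc u v Z]).

Fact nbrDl x y z : nbr (x + y) z = nbr x z + nbr y z.
Proof.
congr pair => /=; first by rewrite addr0.
apply/ffunP => Z; rewrite !ffunE -big_split; apply: eq_bigr => u _ /=.
by rewrite -big_split; apply: eq_bigr => v _ /=; rewrite ffunE !mulrDl.
Qed.

Fact nbrZl (a : R) x y : nbr (a *: x) y = a *: nbr x y.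
Proof.
congr pair => /=; first by rewrite scaler0.
apply/ffunP => Z; rewrite !ffunE scaler_sumr; apply: eq_bigr => u _ /=.
by rewrite scaler_sumr; apply: eq_bigr => v _ /=; rewrite ffunE /GRing.scale /= !mulrA.
Qed.

Fact nbrC x y : nbr x y = - nbr y x.
Proof.
congr pair => /=; first by rewrite oppr0.
apply/ffunP => Z; rewrite !ffunE exchange_big -sumrN; apply: eq_bigr => u _ /=.
rewrite -sumrN; apply: eq_bigr => v _ /=.
by rewrite -mulrN opprB (mulrC (x.1 v)).
Qed.

Fact nbrDr x y z : nbr x (y + z) = nbr x y + nbr x z.
Proof. by rewrite nbrC nbrDl opprD -!nbrC. Qed.

Fact nbrZr (a : R) x y : nbr x (a *: y) = a *: nbr x y.
Proof. by rewrite nbrC nbrZl -scalerN -nbrC. Qed.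

Fact nbrxx x : nbr x x = 0.
Proof.
have /eqP := nbrC x x.
by rewrite -addr_eq0 -mulr2n -scaler_nat scaler_eq0 pnatr_eq0 => /eqP.
Qed.

Fact nbr_nbr x y z : nbr x (nbr y z) = 0.
Proof.
congr pair => /=; apply/ffunP => Z; rewrite !ffunE big1 // => u _.
by rewrite big1 // => v _; rewrite ffunE mulr0 mul0r.
Qed.

Fact nbr_jacobi x y z : nbr x (nbr y z) + nbr y (nbr z x) + nbr z (nbr x y) = 0.
Proof. by rewrite !nbr_nbr !addr0. Qed.

HB.instance Definition _ := isLieAlgebra.Build R nG
  nbrDl nbrZl nbrDr nbrZr nbrxx nbr_jacobi.

Lemma lie_vvec u v : lie (vvec u) (vvec v) = \sum_Z structc u v Z *: zvec Z.
Proof.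
apply/eqP; rewrite -pair_eqE; apply/andP; split; apply/eqP.
  by rewrite raddf_sum big1 // => Z _ /=; rewrite scaler0.
rewrite raddf_sum; apply/ffunP => Z; rewrite sum_ffunE ffunE.
rewrite (bigD1 u) //= [X in _ + X]big1 => [|u' /negPf u'u]; last first.
  by rewrite big1 // => v' _; rewrite ffunE u'u !mul0r.
rewrite addr0 (bigD1 v) //= [X in _ + X]big1 => [|v' /negPf v'v]; last first.
  by rewrite [X in _ * X * _]ffunE v'v mulr0 mul0r.
rewrite addr0 !ffunE !eqxx !mul1r (bigD1 Z) //= big1 => [|Y /negPf YZ].
  by rewrite addr0 !ffunE eqxx [RHS]mulr1.
by rewrite !ffunE eq_sym YZ scaler0.
Qed.

Lemma mem_vpart x : (x \in vpart) = (x.2 == 0).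
Proof.
apply/idP/eqP => [/coord_span ->|x2].
  rewrite raddf_sum big1 // => i _ /=.
  have /mapP[v _ ->] : (image_tuple vvec V)`_i \in image vvec V.
    by rewrite mem_nth // size_tuple.
  by rewrite scaler0.
have -> : x = \sum_v x.1 v *: vvec v.
  apply/eqP; rewrite -pair_eqE; apply/andP; split; apply/eqP; rewrite raddf_sum.
    apply/ffunP => v; rewrite sum_ffunE (bigD1 v) //= !ffunE eqxx.
    rewrite big1 => [|u /negPf uv]; first by rewrite addr0 [RHS]mulr1.
    by rewrite !ffunE eq_sym uv scaler0.
  by rewrite x2 big1 // => v _ /=; rewrite scaler0.
by apply: rpred_sum => v _; rewrite rpredZ // memv_span // map_f ?mem_enum.
Qed.

Lemma mem_zpart x : (x \in zpart) = (x.1 == 0).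
Proof.
apply/idP/eqP => [/coord_span ->|x1].
  rewrite raddf_sum big1 // => i _ /=.
  have /mapP[Z _ ->] : (image_tuple zvec C)`_i \in image zvec C.
    by rewrite mem_nth // size_tuple.
  by rewrite scaler0.
have -> : x = \sum_Z x.2 Z *: zvec Z.
  apply/eqP; rewrite -pair_eqE; apply/andP; split; apply/eqP; rewrite raddf_sum.
    by rewrite x1 big1 // => Z _ /=; rewrite scaler0.
  apply/ffunP => Z; rewrite sum_ffunE (bigD1 Z) //= !ffunE eqxx.
  rewrite big1 => [|Y /negPf YZ]; first by rewrite addr0 [RHS]mulr1.
  by rewrite !ffunE eq_sym YZ scaler0.
by apply: rpred_sum => Z _; rewrite rpredZ // memv_span // map_f ?mem_enum.
Qed.

Lemma vpart_zpart_full : (zpart + vpart)%VS = fullv.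
Proof.
apply/vspaceP => x; rewrite memvf.
have -> : x = (0, x.2) + (x.1, 0).
  by case: x => x1 x2; congr pair; rewrite /= ?add0r ?addr0.
by rewrite memv_add ?mem_zpart ?mem_vpart.
Qed.

Lemma zpart_vpart0 : (zpart :&: vpart)%VS = 0%VS.
Proof.
apply/eqP; rewrite -subv0; apply/subvP => -[x1 x2].
by rewrite memv_cap mem_zpart mem_vpart => /andP[/eqP /= -> /eqP /= ->]; apply: mem0v.
Qed.

Lemma zpart_center : (zpart <= center nG)%VS.
Proof.
apply/subvP => z; rewrite mem_zpart => /eqP z1; apply/centerP => x.
congr pair; apply/ffunP => Z; rewrite !ffunE big1 // => u _.
by rewrite big1 // => v _; rewrite z1 ffunE !mul0r.
Qed.

Lemma derived_simple : simple_graph G -> derived nG = zpart.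
Proof.
move=> sG; apply/eqP; rewrite eqEsubv; apply/andP; split.
  by apply: derived_min => x y; rewrite mem_zpart.
apply/span_subvP => _ /mapP[Z _ ->].
have [[[u v] uvG] <-] := label_surj G Z; set e := exist (fun e => e \in edges G) (u, v) uvG.
suff <- : lie (vvec u) (vvec v) = zvec (label G e) by apply: mem_derived.
have nvu Y : labeled G v u Y = false.
  apply/existsP => -[[f fG] /andP[/eqP /= fE _]].
  by move: fG; rewrite fE (negPf (sG _ _ uvG)).
have uvE Y : labeled G u v Y = (Y == label G e).
  apply/existsP/eqP => [[f /andP[/eqP fE /eqP <-]]|->].
    by congr (label G); apply: val_inj.
  by exists e; rewrite !eqxx.
rewrite lie_vvec (bigD1 (label G e)) //= big1 => [|Y /negPf Ye].
  by rewrite /structc uvE nvu eqxx subr0 scale1r addr0.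
by rewrite /structc uvE nvu Ye subrr scale0r.
Qed.

(* [directv] would look inside [derived] and demand that its summands be
   independent, so directness is stated as a trivial intersection. *)
Definition abelian_factor (a : {vspace nG}) : Prop :=
  [/\ (a <= vpart)%VS, center nG = (derived nG + a)%VS
    & (derived nG :&: a)%VS = 0%VS].

Lemma abelian_factor_exists_unique :
  simple_graph G -> exists! a, abelian_factor a.
Proof.
move=> sG; rewrite /abelian_factor (derived_simple sG).
exists (vpart :&: center nG)%VS; split; first split.
- exact: capvSl.
- by rewrite vspace_modl ?zpart_center // vpart_zpart_full capfv.
- by rewrite capvA zpart_vpart0 cap0v.
move=> b [bv bE bdir]; apply/esym/eqP.
rewrite eqEsubv subv_cap bv /=; apply/andP; split; first by rewrite bE addvSr.
apply/subvP => x; rewrite memv_cap => /andP[xv].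
rewrite bE => /memv_addP[z zz [y yb xE]].
suff z0 : z = 0 by rewrite xE z0 add0r.
apply/eqP; rewrite -memv0 -zpart_vpart0 memv_cap zz /=.
have -> : z = x - y by rewrite xE addrK.
by rewrite rpredB // (subvP bv).
Qed.

End NLie.

(* The ordinal [i : 'I_n] stands for the vertex $v_{i+1}$. *)
Definition std_cycle (n : nat) (C : finType) (G : lgraph 'I_n C) : Prop :=
  edges G = [set e | e.2 == ordS e.1].

Lemma std_cycle_simple (n : nat) (C : finType) (G : lgraph 'I_n C) :
  (2 < n)%N -> std_cycle G -> simple_graph G.
Proof.
move=> n3 GE u v; rewrite GE !inE /= => /eqP ->; apply/eqP => /(congr1 val) /=.
case: u => u /= un.
have [lt1|] := ltnP u.+1 n.
  rewrite (modn_small lt1); have [lt2|ge2] := ltnP u.+2 n.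
    by rewrite modn_small // => /eqP; rewrite -addn2 -{1}[u]addn0 eqn_add2l.
  have -> : u.+2 = n by apply/eqP; rewrite eqn_leq ge2 lt1.
  by rewrite modnn => u0; move: ge2; rewrite u0 leqNgt n3.
move=> ge1; have En : u.+1 = n by apply/eqP; rewrite eqn_leq ge1 un.
rewrite En modnn modn_small ?(ltn_trans _ n3) // => u1.
by move: n3; rewrite -En u1.
Qed.

(* Main.v *)
Require Import Defs.
From HB Require Import structures.
From mathcomp Require Import all_boot all_order all_algebra.
From mathcomp Require Import reals.

Set Implicit Arguments.
Unset Strict Implicit.
Unset Printing Implicit Defensive.

Import Order.TTheory GRing.Theory Num.Theory.
Local Open Scope ring_scope.

(** For a simple graph, the abelian factor is the intersection of the center
    with the span of the vertices ([abelian_factorE]), and a vector is central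
    when its brackets with all vertices vanish ([mem_center]).  In a
    single-label standard cycle, the bracket of [x] with the vertex [v] is
    (coefficient of [x] at the predecessor of [v], minus its coefficient at the
    successor of [v]) times the unique label, because [v] only meets these two
    neighbours and both edges carry the same label.  So [x] lies in the abelian
    factor exactly when its vertex coefficients are invariant under moving two
    steps along the cycle ([mem_abelian_factor_cycle]).

    The coefficient at a vertex is then determined by the parity of its
    position ([two_step_parity]).  If the cycle has even length, parity is well
    defined around the cycle and the coefficients at the first two vertices are
    free, giving the sums over every other vertex.  If it has odd length, going once
    around exchanges the two parities, so the coefficients are all equal. *)

Section SimpleGraph.
Variables (R : realType) (V C : finType) (G : lgraph V C).
Implicit Types x y : nLie R G.

Lemma nLie_eqP x y : x.1 =1 y.1 -> x.2 = y.2 -> x = y.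
Proof. by case: x y => [x1 x2] [y1 y2] /= /ffunP -> ->. Qed.

Lemma sum_vvec1 (P : pred V) u :
  (\sum_(v | P v) vvec R G v).1 u = (P u)%:R :> R.
Proof.
rewrite (raddf_sum (@fst _ _)) sum_ffunE.
under eq_bigr => v _ do rewrite ffunE.
case Pu: (P u); last first.
  rewrite big1 // => v Pv; case: eqP => // uv.
  by move: Pu; rewrite uv Pv.
rewrite (bigD1 u) //= eqxx big1 ?addr0 // => v /andP[_ /negPf].
by rewrite eq_sym => ->.
Qed.

Lemma sum_vvec2 (P : pred V) : (\sum_(v | P v) vvec R G v).2 = 0.
Proof. by rewrite (raddf_sum (@snd _ _)) big1. Qed.

(** The modular law: the center is [zpart + a] with [a] inside [vpart], and
    [zpart] meets [vpart] trivially. *)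
Lemma abelian_factorE (a : {vspace nLie R G}) :
  simple_graph G -> abelian_factor a ->
  a = (vpart R G :&: center (nLie R G))%VS.
Proof.
move=> sG [av cE _].
rewrite cE derived_simple // -vspace_modr //.
by rewrite capvC zpart_vpart0 add0v.
Qed.

(** By bilinearity it is enough to test brackets against vertices. *)
Lemma mem_center x :
  reflect (forall v Z, \sum_u x.1 u * structc R G u v Z = 0 :> R)
          (x \in center (nLie R G)).
Proof.
apply: (iffP (centerP _)) => [x0 v Z|x0 y].
  have /(congr1 (fun y : nLie R G => y.2 Z)) := x0 (vvec R G v).
  rewrite /= !ffunE => sum0; rewrite -[RHS]sum0.
  apply: eq_bigr => u _.
  rewrite (bigD1 v) //= ffunE eqxx mulr1 big1 ?addr0 // => w /negPf wv.
  by rewrite ffunE wv mulr0 mul0r.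
apply: nLie_eqP => //; apply/ffunP => Z.
rewrite /= !ffunE exchange_big /= big1 // => v _.
under eq_bigr => u _ do rewrite mulrAC.
by rewrite -mulr_suml x0 mul0r.
Qed.

End SimpleGraph.

Lemma val_iter_ordS n m (i : 'I_n) : iter m (@ordS n) i = ((i + m) %% n)%N :> nat.
Proof.
elim: m => [|m IHm] /=; first by rewrite addn0 modn_small.
by rewrite IHm addnS -addn1 modnDml addn1.
Qed.

Lemma odd_ordS n (i : 'I_n) : ~~ odd n -> odd (ordS i) = ~~ odd i.
Proof. by move=> nE; rewrite /= odd_mod ?(negPf nE). Qed.

Section TwoStep.
Variables (T : Type) (n : nat) (f : 'I_n -> T).
Hypothesis f2 : forall i, f (ordS (ordS i)) = f i.

Lemma two_step_iter m i : f (iter m (@ordS n) i) = f (iter (odd m) (@ordS n) i).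
Proof.
rewrite -{1}(odd_double_half m) addnC.
elim: m./2 => [|k IHk] //.
by rewrite doubleS !addSn !iterS f2.
Qed.

Lemma two_step_parity (i0 i : 'I_n) : i0 = 0%N :> nat ->
  f i = if odd i then f (ordS i0) else f i0.
Proof.
move=> i00; have {1}-> : i = iter i (@ordS n) i0.
  by apply: val_inj; rewrite /= val_iter_ordS i00 add0n modn_small.
by rewrite two_step_iter; case: odd.
Qed.

(** Going once around an odd cycle turns two-step invariance into
    one-step invariance. *)
Lemma two_step_odd (i : 'I_n) : odd n -> f (ordS i) = f i.
Proof.
move=> n_odd; have {2}-> : i = iter n (@ordS n) i.
  by apply: val_inj; rewrite /= val_iter_ordS modnDr modn_small.
by rewrite two_step_iter n_odd.
Qed.

End TwoStep.

Section Cycle.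
Variables (R : realType) (n : nat) (C : finType) (G : lgraph 'I_n C).
Hypotheses (n3 : (2 < n)%N) (cycG : std_cycle G).
Hypothesis one_label : forall e f, label G e = label G f.

(** The labelling is surjective, so the single label is every [Z]. *)
Lemma labeled_cycle u v Z : labeled G u v Z = (v == ordS u).
Proof.
apply/existsP/eqP => [[[e eG] /andP[/eqP /= eE _]]|vE].
  by move: eG; rewrite eE cycG inE => /eqP.
have uvG : (u, v) \in edges G by rewrite cycG inE vE.
exists (exist (fun e => e \in edges G) (u, v) uvG); rewrite eqxx /=.
by have [f <-] := label_surj G Z; apply/eqP.
Qed.

Lemma sum_structc_cycle (f : 'I_n -> R) v Z :
  \sum_u f u * structc R G u v Z = f (ord_pred v) - f (ordS v).
Proof.
under eq_bigr => u _ do rewrite /structc !labeled_cycle mulrBr.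
rewrite sumrB; congr (_ - _).
  rewrite (bigD1 (ord_pred v)) //= ord_predK eqxx mulr1 big1 ?addr0 // => u.
  by rewrite -(inj_eq (@ordS_inj n)) ord_predK eq_sym => /negPf->; rewrite mulr0.
by rewrite (bigD1 (ordS v)) //= eqxx mulr1 big1 ?addr0 // => u /negPf->; rewrite mulr0.
Qed.

(** The bracket with [ordS v] compares the coefficients at [v] and at
    [ordS (ordS v)]. *)
Lemma mem_abelian_factor_cycle (a : {vspace nLie R G}) x :
  abelian_factor a ->
  x \in a <-> x.2 = 0 /\ forall v, x.1 (ordS (ordS v)) = x.1 v.
Proof.
move=> /(abelian_factorE (std_cycle_simple n3 cycG)) ->.
rewrite memv_cap mem_vpart; split.
  case/andP => /eqP x2 /mem_center x0; split=> // v.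
  have vG : (v, ordS v) \in edges G by rewrite cycG inE.
  have := x0 (ordS v) (label G (exist (fun e => e \in edges G) _ vG)).
  by rewrite sum_structc_cycle ordSK => /eqP; rewrite subr_eq0 => /eqP.
case=> -> x2; rewrite eqxx; apply/mem_center => v Z.
by rewrite sum_structc_cycle -(x2 (ord_pred v)) ord_predK subrr.
Qed.

End Cycle.

Lemma basis_of_dim (K : fieldType) (vT : vectType K) (U : {vspace vT}) X d :
  size X = d -> basis_of U X -> \dim U = d /\ basis_of U X.
Proof. by move=> <- bX; split=> //; case/andP: bX => /eqP <- /eqP. Qed.

Theorem theorem4p2 (R : realType) (n : nat) (C : finType) (G : lgraph 'I_n C)
    (a : {vspace nLie R G}) :
  (3 <= n)%N ->
  std_cycle G ->
  (forall e f, label G e = label G f) ->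
  abelian_factor a ->
  (forall k : nat, n = (2 * k)%N ->
     \dim a = 2%N /\
     basis_of a [:: \sum_(i < n | odd i.+1) vvec R G i;
                    \sum_(i < n | ~~ odd i.+1) vvec R G i]) /\
  (odd n ->
     \dim a = 1%N /\
     basis_of a [:: \sum_(i < n) vvec R G i]).
Proof.
move=> n3 cycG one_label aF.
have aP x := mem_abelian_factor_cycle n3 cycG one_label x aF.
pose i0 : 'I_n := Ordinal (ltn_trans (isT : 0 < 2)%N n3).
have i1E : ordS i0 = 1%N :> nat by rewrite /= modn_small // (ltn_trans _ n3).
split=> [k nE|n_odd]; apply: basis_of_dim => //.
  have n_even : ~~ odd n by rewrite nE mul2n odd_double.
  set A := \sum_(i < n | _) _; set B := \sum_(i < n | _) _.
  (* Ordinals count from 0: [A] collects the ordinals of even value. *)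
  have A1 u : A.1 u = (~~ odd u)%:R by rewrite sum_vvec1.
  have B1 u : B.1 u = (odd u)%:R by rewrite sum_vvec1 /= negbK.
  have A2 : A.2 = 0 by apply: sum_vvec2.
  have B2 : B.2 = 0 by apply: sum_vvec2.
  have aA : A \in a by apply/aP; split=> // v; rewrite !A1 !odd_ordS // negbK.
  have aB : B \in a by apply/aP; split=> // v; rewrite !B1 !odd_ordS // negbK.
  apply/andP; split; last first.
    rewrite free_cons seq1_free span_seq1; apply/andP; split.
      apply/vlineP => -[c /(congr1 (fun x : nLie R G => x.1 i0))].
      rewrite /= A1 ffunE B1 /= scaler0 => /eqP.
      by rewrite oner_eq0.
    apply/eqP => /(congr1 (fun x : nLie R G => x.1 (ordS i0))).
    by rewrite B1 i1E ffunE => /eqP; rewrite oner_eq0.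
  rewrite eqEsubv; apply/andP; split.
    by apply/span_subvP => x; rewrite !inE => /orP[] /eqP ->.
  apply/subvP => x /aP[x2 x_two_step].
  have -> : x = x.1 i0 *: A + x.1 (ordS i0) *: B.
    apply: nLie_eqP => [u|] /=; last by rewrite A2 B2 !scaler0 addr0.
    rewrite (two_step_parity x_two_step u (erefl : i0 = 0%N :> nat)).
    rewrite !ffunE A1 B1.
    by case: odd; rewrite /= ?scaler0 ?add0r ?addr0 [RHS]mulr1.
  by rewrite rpredD ?rpredZ // memv_span // !inE eqxx ?orbT.
set S := \sum_(i < n) _.
have S1 u : S.1 u = 1 by rewrite sum_vvec1.
have S2 : S.2 = 0 by apply: sum_vvec2.
have aS : S \in a by apply/aP; split=> // v; rewrite !S1.
apply/andP; split; last first.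
  rewrite seq1_free; apply/eqP => /(congr1 (fun x : nLie R G => x.1 i0)).
  by rewrite S1 ffunE => /eqP; rewrite oner_eq0.
rewrite span_seq1 eqEsubv -memvE aS; apply/subvP => x /aP[x2 x_two_step].
apply/vlineP; exists (x.1 i0).
apply: nLie_eqP => [u|] /=; last by rewrite S2 scaler0.
rewrite (two_step_parity x_two_step u (erefl : i0 = 0%N :> nat)).
by rewrite two_step_odd // if_same ffunE S1 [RHS]mulr1.
Qed.
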